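(* Let $G=(V,E)$ be a simple undirected graph with vertices $v_1,\dots,v_N$, and let $\mathfrak{H}_G$ be the associated linear space of Hamiltonians. Then the Gibbs variety $\mathrm{GV}(\mathfrak{H}_G)\subseteq\mathbb{S}^{2^N}$ is an independence model on $N$ binary random variables after a linear change of coordinates.
   Context: $\mathbb{S}^{n}$ is the affine space of complex symmetric $n\times n$ matrices. Let $\sigma_X=\begin{pmatrix}0&1\\1&0\end{pmatrix}$ and $\sigma_Z=\begin{pmatrix}1&0\\0&-1\end{pmatrix}$. To each vertex $v_i$ of $G$ associate the real symmetric $2^N\times 2^N$ matrix $H_i=\bigotimes_{j=1}^N H_{i,j}$ with $H_{i,j}=\sigma_X$ if $i=j$, $H_{i,j}=\sigma_Z$ if $\{v_i,v_j\}\in E$, and $H_{i,j}=\mathrm{Id}_2$ otherwise. Let $\mathfrak{H}_G=\langle H_1,\dots,H_N\rangle$ be the real linear span. For a linear space $\mathcal{L}$ of real symmetric $n\times n$ matrices, the Gibbs variety $\mathrm{GV}(\mathcal{L})$ is the Zariski closure in $\mathbb{S}^n$ of $\exp(\mathcal{L})=\{\exp(L)\mid L\in\mathcal{L}\}$ ($\exp$ is the matrix exponential). The independence model on $N$ binary random variables is taken here in the following affine form. Let $A$ be the $N\times 2^N$ matrix whose columns $a^{(1)},\dots,a^{(2^N)}$ are the vertices of the hypercube $[-1,1]^N$, i.e. all vectors in $\{-1,1\}^N$. Let $X_A\subseteq\mathbb{C}^{2^N}$ be the affine toric variety of $A$, i.e. the Zariski closure of the image of $(\mathbb{C}^* )^N\to\mathbb{C}^{2^N}$,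 $t\mapsto(t^{a^{(1)}},\dots,t^{a^{(2^N)}})$. (It is an affine patch of the Segre variety $\mathbb{P}^1\times\dots\times\mathbb{P}^1\subseteq\mathbb{P}^{2^N-1}$.) The statement ''a variety in $\mathbb{S}^{2^N}$ is an independence model after a linear change of coordinates'' means that there is an invertible linear map $\mathbb{S}^{2^N}\to\mathbb{S}^{2^N}$ carrying it onto $\{\mathrm{diag}(x)\mid x\in X_A\}$. *)

(* Defs.v *)
From HB Require Import structures.
From mathcomp Require Import all_boot all_order all_algebra.
From mathcomp Require Import complex mxtens.
(* mpoly is not imported: its notations clash with those of the analysis
   library. *)
From mathcomp Require mpoly.
From mathcomp Require Import all_classical all_reals all_analysis.

Set Implicit Arguments.
Unset Strict Implicit.
Unset Printing Implicit Defensive.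

Import Order.TTheory GRing.Theory Num.Theory.
Import numFieldNormedType.Exports.

Local Open Scope classical_set_scope.
Local Open Scope ring_scope.
Local Open Scope complex_scope.

Definition symv (F : fieldType) (n : nat) : {vspace 'M[F]_n} :=
  fixedSpace (linfun (@trmx F n n)).

Lemma symvP (F : fieldType) (n : nat) (A : 'M[F]_n) :
  reflect (A^T = A) (A \in symv F n).
Proof. by apply: (iffP fixedSpaceP); rewrite lfunE. Qed.

(* The space S^n of complex symmetric matrices, as a type; [vsval] is its
   inclusion into the space of all matrices. *)
Definition symmx (R : realType) (n : nat) : vectType R[i] :=
  subvs_of (symv R[i] n).

(* Polynomial functions on a finite-dimensional space V are polynomials in the
   coordinates with respect to some basis; the class of these functions, hence
   the closure, does not depend on which basis is used. *)
Definition zariski_closure (F : fieldType) (V : vectType F) (S : set V) :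
    set V :=
  let coords (x : V) := fun i : 'I_(\dim {:V}) => coord (vbasis {:V}) i x in
  [set x | forall p : mpoly.mpoly (\dim {:V}) F,
     (forall y, S y -> mpoly.meval (coords y) p = 0) ->
     mpoly.meval (coords x) p = 0].

Definition expmx (R : realType) (n : nat) (A : 'M[R]_n) : 'M[R]_n :=
  limn (series (fun k => k`!%:R^-1 *: A ^+ k)).

(* Intended for L consisting of symmetric matrices, whose exponentials are
   symmetric. *)
Definition gibbs_variety (R : realType) (n : nat) (L : {vspace 'M[R]_n}) :
    set (symmx R n) :=
  zariski_closure [set X : symmx R n | exists2 A : 'M[R]_n, A \in L &
    vsval X = map_mx (real_complex R) (expmx A)].

Definition sigmaX (F : fieldType) : 'M[F]_2 :=
  \matrix_(i, j) (i != j)%:R.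

Definition sigmaZ (F : fieldType) : 'M[F]_2 :=
  \matrix_(i, j) (if i != j then 0 else if i == 0 then 1 else -1).

(* The iterated Kronecker product B_0 (x) (B_1 (x) ... (x) B_(N-1)). *)
Fixpoint tens_family (F : fieldType) (N : nat) :
    ('I_N -> 'M[F]_2) -> 'M[F]_(2 ^ N) :=
  match N return ('I_N -> 'M[F]_2) -> 'M[F]_(2 ^ N) with
  | 0 => fun _ => 1%:M
  | M.+1 => fun B =>
      castmx (esym (expnS 2 M), esym (expnS 2 M))
        (B ord0 *t tens_family (fun j => B (lift ord0 j)))
  end.

(* [e] is the adjacency relation of the graph. *)
Definition hamiltonian_factor (F : fieldType) (N : nat) (e : rel 'I_N)
    (i j : 'I_N) : 'M[F]_2 :=
  if i == j then sigmaX F else if e i j then sigmaZ F else 1%:M.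

Definition hamiltonian (F : fieldType) (N : nat) (e : rel 'I_N) (i : 'I_N) :
    'M[F]_(2 ^ N) :=
  tens_family (hamiltonian_factor F e i).

Definition hamiltonian_space (R : realType) (N : nat) (e : rel 'I_N) :
    {vspace 'M[R]_(2 ^ N)} :=
  <<[seq hamiltonian R e i | i <- enum 'I_N]>>%VS.

Lemma tr_tens_family (F : fieldType) (N : nat) (B : 'I_N -> 'M[F]_2) :
  (forall j, (B j)^T = B j) -> (tens_family B)^T = tens_family B.
Proof.
elim: N B => [|N IHN] B symB /=; first by rewrite trmx1.
by rewrite trmx_cast /= trmx_tens symB IHN.
Qed.

Lemma hamiltonian_space_sym (R : realType) (N : nat) (e : rel 'I_N) :
  (hamiltonian_space R e <= symv R (2 ^ N))%VS.
Proof.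
apply/span_subvP => _ /mapP[i _ ->]; apply/symvP/tr_tens_family => j.
rewrite /hamiltonian_factor; case: ifP => _.
  by apply/matrixP => a b; rewrite !mxE eq_sym.
case: ifP => _; last by rewrite trmx1.
by apply/matrixP => a b; rewrite !mxE eq_sym; case: (eqVneq a b) => [->|].
Qed.

Lemma card_hypercube (N : nat) : #|{ffun 'I_N -> bool}| = (2 ^ N)%N.
Proof. by rewrite card_ffun card_bool card_ord. Qed.

(* The columns are the sign vectors in {-1,1}^N, each exactly once, in the
   order in which the finite type {ffun 'I_N -> bool} is enumerated. *)
Definition hypercube_mx (N : nat) : 'M[int]_(N, 2 ^ N) :=
  \matrix_(i, k)
    (if (enum_val (cast_ord (esym (card_hypercube N)) k) :
           {ffun 'I_N -> bool}) i
     then 1 else -1).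

Definition affine_toric_variety (R : realType) (N m : nat)
    (A : 'M[int]_(N, m)) : set 'rV[R[i]]_m :=
  zariski_closure [set x : 'rV[R[i]]_m | exists2 t : 'I_N -> R[i],
    (forall i, t i != 0) & x = \row_k \prod_(i < N) t i ^ A i k].

Definition independence_model_up_to_linear_change (R : realType) (N : nat)
    (V : set (symmx R (2 ^ N))) : Prop :=
  exists2 phi : {linear symmx R (2 ^ N) -> symmx R (2 ^ N)}, bijective phi &
    (fun X => vsval (phi X)) @` V =
    (fun x => diag_mx x) @` affine_toric_variety (R := R) (hypercube_mx N).

(* Main.v *)
Require Import Defs.
From HB Require Import structures.
From mathcomp Require Import all_boot all_order all_algebra.
From mathcomp Require Import complex mxtens.
From mathcomp Require mpoly.
Import (canonicals, coercions) mpoly.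
From mathcomp Require Import all_classical all_reals all_analysis.

(** The generators [H_i] are commuting involutions: a factor of [H_i] and the
    factor of [H_j] in the same position commute, except that [sigmaX] and
    [sigmaZ] meet, and anticommute, in exactly the two positions [i] and [j]
    when the vertices are adjacent; the two signs cancel. Hence for each sign
    vector [a] in [{-1,1}^N] the matrix [P_a = 2^-N prod_i (1 + a_i H_i)] is
    the projector onto the joint eigenspace where [H_i] acts as [a_i]. These
    projectors are symmetric, mutually orthogonal and sum to the identity
    ([graph_proj_sym], [graph_proj_mul], [sum_graph_proj]). None of them is
    zero: conjugation by a tensor product of factors [1] and [sigmaZ] changes
    the signs of any chosen [H_i], so it carries each [P_a] to any other, and
    one vanishing projector would force all of them, hence also their sum, to
    vanish ([graph_proj_neq0]).

    The exponential series can then be summed on each joint eigenspace: [exp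
    (sum_i y_i H_i) = sum_a exp <y, a> P_a = sum_a t^a P_a] with [t_i = exp
    y_i] ([expmx_hamiltonian]). So [exp] of the space of Hamiltonians is the
    image of the real positive part of the torus under the monomial map [t |->
    (t^a)_a], followed by the linear embedding [x |-> sum_a x_a P_a], which is
    injective because the [P_a] are linearly independent.

    Two facts on Zariski closures remain. Closure commutes with injective
    linear maps ([zariski_closure_injective]), and the positive real points of
    a monomial map have the same closure as all of its points
    ([monomial_map_dense]), since a Laurent polynomial with infinitely many
    zeros vanishes. The Gibbs variety is therefore [{sum_a x_a P_a | x in
    X_A}].

    Since an arbitrary linear change of coordinates is allowed, diagonalizing
    the [P_a] by an explicit orthogonal matrix can be avoided: any two linearly
    independent families of the same size are exchanged by a linear bijection
    ([free_extend_linear_bijection]), and it is applied to the [P_a] and the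
    diagonal matrix units. *)

Set Implicit Arguments.
Unset Strict Implicit.
Unset Printing Implicit Defensive.

Import Order.TTheory GRing.Theory Num.Theory.
Import numFieldNormedType.Exports.

Local Open Scope classical_set_scope.
Local Open Scope ring_scope.

(** * Zariski closures and linear maps *)

(** A linear map is Zariski continuous: substituting linear forms for the
    coordinates pulls a polynomial vanishing on the image back to one vanishing
    on the source. *)
Lemma zariski_closure_linear (F : fieldType) (V W : vectType F)
    (h : {linear V -> W}) (S : set V) (x : V) :
  zariski_closure S x -> zariski_closure (h @` S) (h x).
Proof.
move=> Sx p p0.
pose cV := vbasis {:V}; pose cW := vbasis {:W}.
pose lq := [tuple \sum_(j < \dim {:V})
    coord cW i (h cV`_j) *: mpoly.mpolyX F (mpoly.mnm1 j)
    | i < \dim {:W}].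
have evalh y : mpoly.meval (fun i => coord cW i (h y)) p =
               mpoly.meval (fun j => coord cV j y) (mpoly.comp_mpoly lq p).
  rewrite mpoly.comp_mpoly_meval; apply: mpoly.meval_eq => i.
  rewrite tnth_mktuple {1}(coord_vbasis (memvf y)) !linear_sum /=.
  by apply: eq_bigr => j _; rewrite !linearZ /= mpoly.mevalXU mulrC.
rewrite evalh; apply: Sx => y Sy; rewrite -evalh.
by apply: p0; exists y.
Qed.

Lemma zariski_closure_origin (F : fieldType) (V : vectType F) (x : V) :
  zariski_closure [set 0] x -> x = 0.
Proof.
move=> x0; rewrite (coord_vbasis (memvf x)) big1 // => i _.
have := x0 (mpoly.mpolyX F (mpoly.mnm1 i)); rewrite mpoly.mevalXU => ->.
  by rewrite scale0r.
by move=> _ ->; rewrite mpoly.mevalXU linear0.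
Qed.

(** With [g] a linear left inverse of [f], a point [w] of the closure of
    [f @` S] satisfies [w = f (g w)], because this linear equation holds on
    [f @` S]; and [g w] lies in the closure of [g @` (f @` S) = S]. *)
Lemma zariski_closure_injective (F : fieldType) (V W : vectType F)
    (f : {linear V -> W}) (S : set V) :
  injective f -> zariski_closure (f @` S) = f @` zariski_closure S.
Proof.
move=> f_inj; apply/seteqP; split => [w Sw|_ [x Sx <-]]; last first.
  exact: zariski_closure_linear.
pose g := ((linfun f)^-1)%VF.
have fK : cancel f g.
  move=> x; rewrite -[f x]lfunE lker0_lfunK //.
  by apply/lker0P => y z; rewrite !lfunE; apply: f_inj.
have gS : g @` (f @` S) = S.
  rewrite image_comp; apply/seteqP; split => [_ [x Sx <-]|x Sx] /=.
    by rewrite fK.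
  by exists x => //=; rewrite fK.
exists (g w); first by rewrite -gS; apply: zariski_closure_linear.
pose r : 'Hom(W, W) := (\1 - (linfun f \o g))%VF.
have rE v : r v = v - f (g v).
  by rewrite add_lfunE opp_lfunE id_lfunE comp_lfunE !lfunE.
suff : r w = 0 by rewrite rE => /subr0_eq.
have rS : r @` (f @` S) `<=` [set 0].
  by move=> _ [_ [x Sx <-] <-] /=; rewrite rE fK subrr.
apply: zariski_closure_origin => p p0.
have Srw : zariski_closure (r @` (f @` S)) (r w) :=
  @zariski_closure_linear _ _ _ r _ _ Sw.
by apply: Srw => y /rS; apply: p0.
Qed.

Lemma zariski_closure_dense (F : fieldType) (V : vectType F) (S T : set V) :
  S `<=` T -> T `<=` zariski_closure S -> zariski_closure S = zariski_closure T.
Proof.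
move=> sST sTS; apply/seteqP; split => x cx p p0; apply: cx => y Sy.
  by apply: p0; apply: sST.
exact: (sTS y Sy).
Qed.

(** * Zariski density in images of monomial maps *)

(** These are the Laurent polynomial functions on [F \ {0}]: multiplying by a
    power of [z] clears the denominator and leaves an ordinary polynomial. *)
Definition laurent (F : fieldType) (u : F -> F) : Prop :=
  exists d (q : {poly F}), forall z, z != 0 -> u z * z ^+ d = q.[z].

Lemma laurent_const (F : fieldType) (c : F) : laurent (fun=> c).
Proof. by exists 0, c%:P => z _; rewrite hornerC expr0 mulr1. Qed.

Lemma laurentD (F : fieldType) (u v : F -> F) :
  laurent u -> laurent v -> laurent (fun z => u z + v z).
Proof.
move=> [d [p up]] [e [q vq]]; exists (d + e)%N, (p * 'X^e + q * 'X^d) => z z0.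
rewrite !hornerE -up // -vq // exprD mulrDl !mulrA; congr (_ + _).
by rewrite mulrAC.
Qed.

Lemma laurentM (F : fieldType) (u v : F -> F) :
  laurent u -> laurent v -> laurent (fun z => u z * v z).
Proof.
move=> [d [p up]] [e [q vq]]; exists (d + e)%N, (p * q) => z z0.
by rewrite hornerM -up // -vq // exprD mulrACA.
Qed.

Lemma laurent_sum (F : fieldType) (I : Type) (r : seq I) (u : I -> F -> F) :
  (forall i, laurent (u i)) -> laurent (fun z => \sum_(i <- r) u i z).
Proof.
move=> Lu; elim: r => [|i r IHr].
  by under eq_fun do rewrite big_nil; apply: laurent_const.
by under eq_fun do rewrite big_cons; apply: laurentD.
Qed.

Lemma laurent_prod (F : fieldType) (I : Type) (r : seq I) (u : I -> F -> F) :
  (forall i, laurent (u i)) -> laurent (fun z => \prod_(i <- r) u i z).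
Proof.
move=> Lu; elim: r => [|i r IHr].
  by under eq_fun do rewrite big_nil; apply: laurent_const.
by under eq_fun do rewrite big_cons; apply: laurentM.
Qed.

Lemma laurent_meval (F : fieldType) (n : nat) (p : mpoly.mpoly n F)
    (u : 'I_n -> F -> F) :
  (forall i, laurent (u i)) -> laurent (fun z => mpoly.meval (u^~ z) p).
Proof.
move=> Lu; under eq_fun do rewrite mpoly.mevalE.
apply: laurent_sum => m; apply: laurentM; first exact: laurent_const.
apply: laurent_prod => i; elim: (m i) => [|k IHk].
  by under eq_fun do rewrite expr0; apply: laurent_const.
by under eq_fun do rewrite exprS; apply: laurentM.
Qed.

Lemma laurent_exprz (F : fieldType) (k : int) : laurent (fun z : F => z ^ k).
Proof.
case: k => k.
  by exists 0, 'X^k => z _; rewrite hornerXn expr0 mulr1.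
by exists k.+1, 1 => z z0; rewrite hornerC NegzE -exprnN mulVf ?expf_neq0.
Qed.

Lemma laurent_eq0 (F : numFieldType) (u : F -> F) :
  laurent u -> (forall n, u n.+1%:R = 0) -> forall z, z != 0 -> u z = 0.
Proof.
move=> [d [q uq]] u0 z z0.
suff q0 : q = 0.
  apply/eqP; move/eqP: (uq z z0).
  by rewrite q0 horner0 mulf_eq0 expf_eq0 (negPf z0) andbF orbF.
apply/eqP/negPn/negP => qN0.
pose s := [seq n.+1%:R : F | n <- iota 0 (size q)].
have : (size s < size q)%N.
  apply: max_poly_roots => //.
    apply/allP => _ /mapP[n _ ->].
    by rewrite /root -uq ?u0 ?mul0r // pnatr_eq0.
  by rewrite map_inj_uniq ?iota_uniq // => a b /eqP; rewrite eqr_nat => /eqP[].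
by rewrite size_map size_iota ltnn.
Qed.

(** The variables are freed from [D] one at a time: with all the others fixed,
    [u] is a Laurent polynomial in the current one and vanishes at every
    positive integer. *)
Lemma laurent_multivariate_eq0 (F : numFieldType) (N : nat) (D : set F)
    (u : ('I_N -> F) -> F) :
  (forall n, D n.+1%:R) ->
  (forall t i, laurent (fun z => u (fun j => if j == i then z else t j))) ->
  (forall t, (forall i, D (t i)) -> u t = 0) ->
  forall t, (forall i, t i != 0) -> u t = 0.
Proof.
move=> Dn Lu u0.
(* Only the variables of index at least [k] are confined to [D]. *)
have step k t : (forall i : 'I_N, t i != 0) ->
    (forall i : 'I_N, (k <= i)%N -> D (t i)) -> u t = 0.
  elim: k t => [|k IHk] t t0 Dt; first by apply: u0 => i; apply: Dt.
  have [kN|kN] := ltnP k N; last first.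
    apply: IHk => // i /(leq_trans kN) /leq_ltn_trans/(_ (ltn_ord i)).
    by rewrite ltnn.
  pose i := Ordinal kN.
  have -> : t = fun j => if j == i then t i else t j.
    by apply/funext => j; case: eqP => [->|].
  apply: (laurent_eq0 (Lu t i)) => // n; apply: IHk => j.
    by case: ifP => // _; rewrite pnatr_eq0.
  case: ifPn => // ji kj; apply: Dt; rewrite ltn_neqAle kj andbT.
  by apply: contra ji => /eqP jk; apply/eqP/val_inj.
by move=> t t0; apply: (step N) => // i; rewrite leqNgt ltn_ord.
Qed.

(** [D] will be the set of positive reals inside the complex numbers, which is
    where the exponentials of real parameters live. *)
Lemma monomial_map_dense (F : numFieldType) (N m : nat) (A : 'M[int]_(N, m))
    (D : set F) :
  (forall n, D n.+1%:R) -> (forall z, D z -> z != 0) ->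
  zariski_closure [set x : 'rV[F]_m | exists2 t : 'I_N -> F,
     (forall i, D (t i)) & x = \row_k \prod_(i < N) t i ^ A i k] =
  zariski_closure [set x : 'rV[F]_m | exists2 t : 'I_N -> F,
     (forall i, t i != 0) & x = \row_k \prod_(i < N) t i ^ A i k].
Proof.
move=> Dn D0; apply: zariski_closure_dense => [_ [t Dt ->]|_ [t t0 ->]].
  by exists t => // i; apply: D0.
move=> p p0 /=.
pose row t : 'rV[F]_m := \row_k \prod_(i < N) t i ^ A i k.
pose u t := mpoly.meval (fun i => coord (vbasis {:'rV[F]_m}) i (row t)) p.
apply: (@laurent_multivariate_eq0 _ _ D u) => // [{t0}t i|{t0}t Dt]; last first.
  by apply: p0; exists t.
apply: laurent_meval => k.
under eq_fun do rewrite [row _]row_sum_delta linear_sum /=.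
apply: laurent_sum => j.
under eq_fun do rewrite linearZ /= mxE.
apply: laurentM; last exact: laurent_const.
apply: laurent_prod => l; case: eqP => _; last exact: laurent_const.
exact: laurent_exprz.
Qed.

(** * The matrix exponential *)

(** Given a resolution of the identity into eigenmatrices of [A], each power
    [A ^+ j] acts on [P k] as the scalar [c k ^+ j], so the matrix series splits
    into scalar exponential series. *)
Lemma expmx_spectral (R : realType) (n m : nat) (A : 'M[R]_n)
    (P : 'I_m -> 'M[R]_n) (c : 'I_m -> R) :
  \sum_k P k = 1%:M -> (forall k, A *m P k = c k *: P k) ->
  expmx A = \sum_k expR (c k) *: P k.
Proof.
move=> P1 AP.
have powA j : A ^+ j = \sum_k c k ^+ j *: P k.
  elim: j => [|j IHj]; first by under eq_bigr do rewrite expr0 scale1r.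
  rewrite exprS IHj -mulmxE mulmx_sumr; apply: eq_bigr => k _.
  by rewrite -scalemxAr AP scalerA exprSr.
apply: cvg_lim => //.
have -> : series (fun j => j`!%:R^-1 *: A ^+ j) =
          (fun j => \sum_k series (exp_coeff (c k)) j *: P k).
  apply/funext => j; rewrite /series /=.
  under eq_bigr do rewrite powA scaler_sumr.
  rewrite exchange_big /=; apply: eq_bigr => k _.
  rewrite scaler_suml; apply: eq_bigr => i _.
  by rewrite scalerA mulrC.
elim: (index_enum _) => [|k r IHr].
  by under eq_fun do rewrite big_nil; rewrite big_nil; apply: cvg_cst.
under eq_fun do rewrite big_cons; rewrite big_cons.
apply: cvgD => //; apply: cvgZr_tmp.
exact: is_cvg_series_exp_coeff.
Qed.

(** * Tensor products of 2 x 2 matrices *)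

Section TensorFamilies.
Variable F : fieldType.

Lemma castmx_mul_square (m m' : nat) (E : m = m') (A B : 'M[F]_m) :
  castmx (E, E) (A *m B) = castmx (E, E) A *m castmx (E, E) B.
Proof. by case: m' / E. Qed.

Lemma tensmx11 (m n : nat) : (1%:M : 'M[F]_m) *t (1%:M : 'M[F]_n) = 1%:M.
Proof.
apply/matrixP => i j.
case: (mxtens_indexP i) => i0 i1; case: (mxtens_indexP j) => j0 j1.
rewrite tensmxE !mxE (inj_eq (can_inj (@mxtens_indexK _ _))) xpair_eqE.
by rewrite -natrM mulnb.
Qed.

Lemma tens_family_mul (N : nat) (B C : 'I_N -> 'M[F]_2) :
  tens_family B *m tens_family C = tens_family (fun j => B j *m C j).
Proof.
elim: N B C => [|N IHN] B C /=; first by rewrite mulmx1.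
by rewrite -castmx_mul_square tensmx_mul IHN.
Qed.

Lemma tens_family_scale (N : nat) (c : 'I_N -> F) (B : 'I_N -> 'M[F]_2) :
  tens_family (fun j => c j *: B j) = (\prod_j c j) *: tens_family B.
Proof.
elim: N c B => [|N IHN] c B /=; first by rewrite big_ord0 scale1r.
rewrite IHN big_ord_recl.
by apply/matrixP => i j; rewrite !(castmxE, mxE) mulrACA.
Qed.

Lemma tens_family1 (N : nat) :
  tens_family (fun _ : 'I_N => 1%:M : 'M[F]_2) = 1%:M.
Proof.
elim: N => //= N ->; rewrite tensmx11.
by apply/matrixP => i j; rewrite castmxE !mxE.
Qed.

(** Tensor products of matrices that commute up to scalars [c j] commute up to
    the product of these scalars. *)
Lemma tens_family_commute (N : nat) (c : 'I_N -> F) (B C : 'I_N -> 'M[F]_2) :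
  (forall j, B j *m C j = c j *: (C j *m B j)) ->
  tens_family B *m tens_family C =
  (\prod_j c j) *: (tens_family C *m tens_family B).
Proof.
move=> BC; rewrite !tens_family_mul -tens_family_scale; congr tens_family.
by apply/funext => j; apply: BC.
Qed.

Lemma mulmx_sigmaXX : sigmaX F *m sigmaX F = 1%:M.
Proof.
apply/matrixP=> i j; rewrite !mxE !big_ord_recr big_ord0 /= !mxE.
by case: i j => [[|[|//]] ?] [[|[|//]] ?] /=;
  rewrite ?(mulr0, mul0r, mulr1, addr0, add0r).
Qed.

Lemma mulmx_sigmaZZ : sigmaZ F *m sigmaZ F = 1%:M.
Proof.
apply/matrixP=> i j; rewrite !mxE !big_ord_recr big_ord0 /= !mxE.
by case: i j => [[|[|//]] ?] [[|[|//]] ?] /=;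
  rewrite ?(mulr0, mul0r, mulr1, addr0, add0r, mulrNN).
Qed.

Lemma mulmx_sigmaZX : sigmaZ F *m sigmaX F = -1 *: (sigmaX F *m sigmaZ F).
Proof.
apply/matrixP=> i j; rewrite !mxE !big_ord_recr !big_ord0 /= !mxE.
by case: i j => [[|[|//]] ?] [[|[|//]] ?] /=;
  rewrite ?(mulr0, mul0r, mulr1, addr0, add0r, mulrNN, mul1r).
Qed.

Lemma mulmx_sigmaXZ : sigmaX F *m sigmaZ F = -1 *: (sigmaZ F *m sigmaX F).
Proof. by rewrite mulmx_sigmaZX scalerA mulrNN mulr1 scale1r. Qed.

End TensorFamilies.

(** * The generators as commuting involutions *)

Section Hamiltonian.
Variables (F : fieldType) (N : nat) (e : rel 'I_N).
Hypothesis e_sym : symmetric e.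

Local Notation H := (hamiltonian F e).

Lemma hamiltonian_sqr i : H i *m H i = 1%:M.
Proof.
rewrite tens_family_mul -[RHS]tens_family1; congr tens_family.
apply/funext => j; rewrite /hamiltonian_factor; case: ifP => _.
  exact: mulmx_sigmaXX.
by case: ifP => _; rewrite ?mulmx1 ?mulmx_sigmaZZ.
Qed.

Lemma hamiltonian_commute i j : H i *m H j = H j *m H i.
Proof.
have [->//|ij] := eqVneq i j.
(* [c k] is the sign by which the factors in position [k] commute. *)
pose c k : F := if ((k == i) || (k == j)) && e i j then -1 else 1.
rewrite (@tens_family_commute _ _ c) => [|k].
  rewrite (bigD1 i) //= (bigD1 j) /= ?[j == i]eq_sym // big1 ?mulr1 => [|k].
    rewrite /c !eqxx orbT /=; case: ifP => _; last by rewrite mulr1 scale1r.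
    by rewrite mulrNN mulr1 scale1r.
  by rewrite /c => /andP[/negPf-> /negPf->].
rewrite /c /hamiltonian_factor ![_ == k]eq_sym.
have [->|ki] := eqVneq k i.
  rewrite (negPf ij) e_sym /=; case: ifP => _; last first.
    by rewrite mulmx1 mul1mx scale1r.
  exact: mulmx_sigmaXZ.
have [->|kj] /= := eqVneq k j.
  case: ifP => _; last by rewrite mulmx1 mul1mx scale1r.
  exact: mulmx_sigmaZX.
by rewrite scale1r; do 2![case: ifP => _]; rewrite ?mulmx1 ?mul1mx.
Qed.

(** For a sign vector [w], conjugation by this matrix sends [H_i] to
    [w_i H_i]. *)
Definition sign_flip (w : 'I_N -> F) : 'M[F]_(2 ^ N) :=
  tens_family (fun j => if w j == 1 then 1%:M else sigmaZ F).

Lemma sign_flip_sqr w : sign_flip w *m sign_flip w = 1%:M.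
Proof.
rewrite tens_family_mul -[RHS]tens_family1; congr tens_family.
by apply/funext => j; case: ifP => _; rewrite ?mulmx1 ?mulmx_sigmaZZ.
Qed.

Lemma sign_flip_hamiltonian w i : w i * w i = 1 ->
  sign_flip w *m H i = w i *: (H i *m sign_flip w).
Proof.
move=> wi.
rewrite (@tens_family_commute _ _ (fun j => if j == i then w i else 1)) => [|j].
  rewrite (bigD1 i) //= eqxx big1 ?mulr1 // => j /negPf -> //.
rewrite /hamiltonian_factor /= [i == j]eq_sym; have [->|ji] := eqVneq j i.
  case: eqP => [wi1|/eqP wi1]; first by rewrite wi1 mul1mx mulmx1 scale1r.
  have -> : w i = -1.
    by apply/eqP; move/eqP: wi; rewrite -expr2 sqrf_eq1 (negPf wi1).
  exact: mulmx_sigmaZX.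
by rewrite scale1r; do 2![case: ifP => _]; rewrite ?mulmx1 ?mul1mx.
Qed.

End Hamiltonian.

(** * Joint spectral projectors of commuting involutions *)

Section JointProjectors.
Variables (F : numFieldType) (n N : nat) (H : 'I_N -> 'M[F]_n).

Let mulr_scaler (a : F) (A B : 'M[F]_n) : A * (a *: B) = a *: (A * B).
Proof. by rewrite -mulmxE scalemxAr. Qed.

Let mulr_scalel (a : F) (A B : 'M[F]_n) : (a *: A) * B = a *: (A * B).
Proof. by rewrite -mulmxE scalemxAl. Qed.

Hypothesis H_sqr : forall i, H i * H i = 1.
Hypothesis H_comm : forall i j, H i * H j = H j * H i.

(** When the [c i] are signs, this is the product of the projectors onto the
    [c i]-eigenspaces of the [H i]. *)
Definition joint_proj (c : 'I_N -> F) : 'M[F]_n :=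
  2 ^- N *: \prod_i (1 + c i *: H i).

Local Notation P := joint_proj.

Lemma joint_proj_eigen c i : c i * c i = 1 -> H i * P c = c i *: P c.
Proof.
move=> ci; rewrite /P mulr_scaler scalerA mulrC -scalerA; congr (_ *: _).
have : i \in index_enum 'I_N by rewrite mem_index_enum.
elim: (index_enum _) => [//|j r IHr]; rewrite !big_cons inE.
case: eqP => [<- _|_ /IHr {}IHr].
  rewrite mulrA -mulr_scalel; congr (_ * _).
  by rewrite mulrDr mulr1 scalerDr scalerA ci scale1r mulr_scaler H_sqr addrC.
rewrite mulrA mulrDr mulr1 mulr_scaler H_comm -mulr_scalel -[X in X + _]mul1r.
by rewrite -mulrDl -mulrA IHr -mulr_scaler.
Qed.

(** Each factor [(1 + c i *: H i) / 2] acts on [P c'] as a scalar, which for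
    sign vectors is 1 or 0 according to whether [c i = c' i]. *)
Lemma joint_proj_mul c c' : (forall i, c' i * c' i = 1) ->
  P c * P c' = (\prod_i ((1 + c i * c' i) / 2)) *: P c'.
Proof.
move=> c'1; rewrite prodf_div prodr_const card_ord mulrC -scalerA.
rewrite {1}/P mulr_scalel; congr (_ *: _).
elim: (index_enum _) => [|j r IHr]; first by rewrite !big_nil mul1r scale1r.
rewrite !big_cons -mulrA IHr mulr_scaler mulrC -scalerA; congr (_ *: _).
rewrite mulrDl mul1r mulr_scalel joint_proj_eigen //.
by rewrite scalerA scalerDl scale1r.
Qed.

Lemma joint_proj_tr c : (forall i, (H i)^T = H i) -> (P c)^T = P c.
Proof.
move=> symH; rewrite linearZ /=; congr (_ *: _).
pose f i := 1 + c i *: H i.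
have symf i : (f i)^T = f i by rewrite linearD linearZ /= symH trmx1.
have commf i j : GRing.comm (f i) (f j).
  apply: commrD; first exact: commr1.
  apply/commr_sym/commrD; first exact: commr1.
  rewrite /GRing.comm !mulr_scaler !mulr_scalel H_comm.
  by rewrite scalerA mulrC -scalerA.
rewrite -/(f _); elim: (index_enum _) => [|j r IHr].
  by rewrite big_nil trmx1.
rewrite big_cons -mulmxE trmx_mul IHr symf mulmxE.
by apply/commr_sym/commr_prod => i _; apply: commf.
Qed.

(** Expanding [prod_i ((1 + H_i) + (1 - H_i)) = 2 ^ N] by distributivity. *)
Lemma sum_joint_proj :
  \sum_(b : {ffun 'I_N -> bool}) P (fun i => if b i then 1 else -1) = 1.
Proof.
pose f i (b : bool) := 1 + (if b then 1 else -1) *: H i.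
rewrite -scaler_sumr -(bigA_distr_bigA f).
have f2 i : \sum_b f i b = 2.
  rewrite big_bool /f /= scale1r scaleN1r.
  by rewrite [LHS](addrACA 1 (H i) 1 (- H i)) subrr addr0.
transitivity (2 ^- N *: \prod_(i < N) (2 : 'M[F]_n)).
  by congr (_ *: _); apply: eq_bigr => i _; apply: f2.
rewrite prodr_const card_ord.
have -> : (2 ^+ N : 'M[F]_n) = (2 ^+ N : F) *: (1 : 'M[F]_n)
  by rewrite -!natrX scaler_nat.
by rewrite scalerA mulVf ?scale1r // expf_neq0 // pnatr_eq0.
Qed.

Lemma joint_proj_conj w c W :
  (forall i, w i * w i = 1) ->
  (forall i, W * H i = w i *: (H i * W)) ->
  W * P c = P (fun i => w i * c i) * W.
Proof.
move=> w1 WH; rewrite /P mulr_scalel mulr_scaler; congr (_ *: _).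
elim: (index_enum _) => [|j r IHr]; first by rewrite !big_nil mul1r mulr1.
rewrite !big_cons mulrA mulrDr mulr1 mulr_scaler WH scalerA -[RHS]mulrA -IHr.
by rewrite [RHS]mulrA [in RHS]mulrDl mul1r mulr_scalel mulrC.
Qed.

End JointProjectors.

(** * Sign vectors *)

Section Hypercube.
Variable N : nat.

Lemma hypercube_mx_sqr i k :
  hypercube_mx N i k * hypercube_mx N i k = 1.
Proof. by rewrite mxE; case: ifP. Qed.

Lemma hypercube_mx_inj k l :
  (forall i, hypercube_mx N i k = hypercube_mx N i l) -> k = l.
Proof.
move=> kl; apply/(@cast_ord_inj _ _ (esym (card_hypercube N)))/enum_val_inj.
by apply/ffunP => i; move: (kl i); rewrite !mxE; do 2![case: ifP].
Qed.

Lemma big_hypercube (V : nmodType) (f : {ffun 'I_N -> bool} -> V) :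
  \sum_b f b =
  \sum_k f (enum_val (cast_ord (esym (card_hypercube N)) k)).
Proof.
apply: reindex; exists (fun b => cast_ord (card_hypercube N) (enum_rank b)).
  by move=> k _; rewrite enum_valK cast_ordKV.
by move=> b _; rewrite cast_ordK enum_rankK.
Qed.

End Hypercube.

(** * The spectral projectors of the Hamiltonians *)

Section GraphProjectors.
Variables (R : realType) (N : nat) (e : rel 'I_N).
Hypothesis e_sym : symmetric e.
Local Notation a := (hypercube_mx N).
Local Notation H := (hamiltonian R e).

Definition graph_proj (k : 'I_(2 ^ N)) : 'M[R]_(2 ^ N) :=
  joint_proj H (fun i => (a i k)%:~R).
Local Notation P := graph_proj.

Let sign_sqr i k : (a i k)%:~R * (a i k)%:~R = 1 :> R.
Proof. by rewrite -intrM hypercube_mx_sqr. Qed.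

Let H_sqr i : H i * H i = 1.
Proof. by rewrite -mulmxE hamiltonian_sqr. Qed.

Let H_comm i j : H i * H j = H j * H i.
Proof. by rewrite -mulmxE hamiltonian_commute. Qed.

Lemma hamiltonian_graph_proj i k : H i *m P k = (a i k)%:~R *: P k.
Proof. by rewrite mulmxE joint_proj_eigen. Qed.

Lemma sum_graph_proj : \sum_k P k = 1%:M.
Proof.
rewrite -[RHS](sum_joint_proj H) big_hypercube; apply: eq_bigr => k _.
congr joint_proj; apply/funext => i.
by rewrite mxE; case: ifP.
Qed.

Lemma graph_proj_sym k : (P k)^T = P k.
Proof.
apply: joint_proj_tr => // i; apply/symvP.
apply: (subvP (hamiltonian_space_sym R e)); apply: memv_span.
by apply: map_f; rewrite mem_enum.
Qed.

Lemma graph_proj_mul k l : P k *m P l = (k == l)%:R *: P l.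
Proof.
rewrite mulmxE joint_proj_mul //; congr (_ *: _).
have [->|kl] := eqVneq k l.
  by rewrite big1 // => i _; rewrite sign_sqr divff ?pnatr_eq0.
have [i akl] : exists i, a i k != a i l.
  apply/existsP; apply: contraNT kl => /existsPn kl.
  by apply/eqP/hypercube_mx_inj => i; apply/eqP; move: (kl i); rewrite negbK.
rewrite (bigD1 i) //=; suff -> : (a i k)%:~R * (a i l)%:~R = -1 :> R.
  by rewrite subrr !mul0r.
by move: akl; rewrite !mxE; do 2![case: ifP => _]; rewrite // ?mul1r ?mulr1.
Qed.

(** The projectors are conjugate to each other by sign flips and sum to 1, so
    none of them can vanish. *)
Lemma graph_proj_neq0 k : P k != 0.
Proof.
apply/eqP => Pk0.
have P0 l : P l = 0.
  (* The quotient of the sign vectors [l] and [k], signs being their own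
     inverses, turns the signs of [P k] into those of [P l]. *)
  pose w i : R := (a i l)%:~R * (a i k)%:~R.
  have w1 i : w i * w i = 1 by rewrite mulrACA !sign_sqr mulr1.
  have := @joint_proj_conj _ _ _ H w (fun i => (a i k)%:~R)
    (sign_flip w) w1 (fun i => sign_flip_hamiltonian e (w1 i)).
  rewrite -/(P k) Pk0 mulr0.
  under [X in joint_proj _ X]funext do rewrite /w -mulrA sign_sqr mulr1.
  move/(congr1 ( *%R^~ (sign_flip w))).
  by rewrite mul0r -mulrA -mulmxE sign_flip_sqr mulmx1.
have := sum_graph_proj; rewrite big1 // => /matrixP.
have pos : (0 < 2 ^ N)%N by rewrite expn_gt0.
move/(_ (Ordinal pos) (Ordinal pos))/eqP.
by rewrite !mxE eqxx eq_sym oner_eq0.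
Qed.

End GraphProjectors.

Lemma hamiltonian_spaceP (R : realType) (N : nat) (e : rel 'I_N)
    (A : 'M[R]_(2 ^ N)) :
  A \in hamiltonian_space R e <->
  exists y : 'I_N -> R, A = \sum_i y i *: hamiltonian R e i.
Proof.
pose X := [tuple hamiltonian R e i | i < N].
split=> [|[y ->]].
  move=> /(@coord_span _ _ _ X) ->; exists (fun i => coord X i A).
  by apply: eq_bigr => i _; rewrite nth_mktuple.
rewrite rpred_sum // => i _; rewrite rpredZ // memv_span //.
by apply/mapP; exists i; rewrite ?mem_enum.
Qed.

Lemma expmx_hamiltonian (R : realType) (N : nat) (e : rel 'I_N)
    (y : 'I_N -> R) : symmetric e ->
  expmx (\sum_i y i *: hamiltonian R e i) =
  \sum_k (\prod_i expR (y i) ^ hypercube_mx N i k) *: graph_proj R e k.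
Proof.
move=> e_sym; rewrite (expmx_spectral (sum_graph_proj R e)
  (c := fun k => \sum_i y i * (hypercube_mx N i k)%:~R)) => [|k].
  apply: eq_bigr => k _; rewrite expR_sum; congr (_ *: _).
  apply: eq_bigr => i _; rewrite mxE.
  by case: ifP => _; rewrite ?mulr1 ?expr1z // mulrN1 expRN.
rewrite mulmx_suml scaler_suml; apply: eq_bigr => i _.
by rewrite -scalemxAl hamiltonian_graph_proj // scalerA.
Qed.

(** * Linear embeddings and changes of coordinates *)

(** Both families are completed to bases, and the bases are matched. *)
Lemma free_extend_linear_bijection (F : fieldType) (V : vectType F) (m : nat)
    (X Y : m.-tuple V) :
  free X -> free Y ->
  exists2 phi : {linear V -> V}, bijective phi & forall k, phi X`_k = Y`_k.
Proof.
pose ext (Z : m.-tuple V) := tval Z ++ vbasis (<<Z>>^C)%VS.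
have basis_ext (Z : m.-tuple V) : free Z -> basis_of fullv (ext Z).
  move=> freeZ; rewrite -(addv_complf <<Z>>%VS) cat_basis ?vbasisP //.
    by apply/directv_addP; rewrite capv_compl.
  by rewrite /basis_of eqxx.
have size_ext (Z : m.-tuple V) : free Z -> size (ext Z) = \dim {:V}.
  by move=> /basis_ext bZ; rewrite -(size_basis (X := in_tuple (ext Z)) bZ).
have iso (Z T : m.-tuple V) : free Z -> free T ->
    {f : {linear V -> V} | map f (ext Z) = ext T}.
  move=> freeZ freeT; have [f fP] := linear_of_free (ext Z) (ext T).
  exists f; apply: fP; last by rewrite !size_ext.
  exact: basis_free (basis_ext Z freeZ).
have isoK (Z T : m.-tuple V) (f g : {linear V -> V}) : free Z ->
    map f (ext Z) = ext T -> map g (ext T) = ext Z -> cancel f g.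
  move=> freeZ fZ gT v.
  suff : (linfun g \o linfun f)%VF = \1%VF :> 'End(V).
    by move/lfunP/(_ v); rewrite comp_lfunE !lfunE.
  apply/(fullv_lfunP _ _ (span_basis (basis_ext Z freeZ)))/eq_in_map.
  rewrite (eq_map (@id_lfunE _ _)) map_id -[RHS]gT -fZ -map_comp.
  by apply: eq_map => x; rewrite /= comp_lfunE !lfunE.
move=> freeX freeY; have [f fP] := iso X Y freeX freeY.
have [g gP] := iso Y X freeY freeX.
exists f; first by exists g; [apply: isoK fP gP|apply: isoK gP fP].
move=> k; have [km|mk] := ltnP k m; last first.
  by rewrite !nth_default ?size_tuple // linear0.
have := congr1 (nth 0 ^~ k) fP.
rewrite /ext map_cat !nth_cat size_map !size_tuple.
by rewrite km (nth_map 0) // size_tuple.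
Qed.

Section LinearCombination.
Variables (F : fieldType) (V : vectType F) (m : nat) (X : m.-tuple V).

Definition lincomb (x : 'rV[F]_m) : V := \sum_k x 0 k *: X`_k.

Lemma lincomb_is_linear : linear lincomb.
Proof.
move=> a x y; rewrite /lincomb scaler_sumr -big_split; apply: eq_bigr => k _.
by rewrite !mxE scalerDl scalerA.
Qed.

HB.instance Definition _ :=
  GRing.isLinear.Build F 'rV[F]_m V _ lincomb lincomb_is_linear.

Lemma lincomb_inj : free X -> injective lincomb.
Proof.
move=> /freeP freeX; apply: raddf_inj => x x0.
by apply/rowP => k; rewrite mxE; apply: freeX x0 k.
Qed.

End LinearCombination.

(** * The Gibbs variety *)

Section GibbsVariety.
Variables (R : realType) (N : nat) (e : rel 'I_N).
Hypothesis e_sym : symmetric e.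
Local Notation C := (R[i])%C.
Local Notation toC := (real_complex R).

Definition graph_projC : (2 ^ N).-tuple (symmx R (2 ^ N)) :=
  [tuple vsproj (symv C (2 ^ N)) (map_mx toC (graph_proj R e k)) | k < 2 ^ N].

Definition unit_diag : (2 ^ N).-tuple (symmx R (2 ^ N)) :=
  [tuple vsproj (symv C (2 ^ N)) (diag_mx (delta_mx 0 k)) | k < 2 ^ N].

Lemma vsval_graph_projC (k : 'I_(2 ^ N)) :
  vsval graph_projC`_k = map_mx toC (graph_proj R e k).
Proof.
rewrite nth_mktuple vsprojK //; apply/symvP.
have := graph_proj_sym R e_sym k.
move: (graph_proj R e k) => P symP; apply/matrixP => i j.
by rewrite !mxE -[in LHS]symP mxE.
Qed.

Lemma vsval_unit_diag (k : 'I_(2 ^ N)) :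
  vsval unit_diag`_k = diag_mx (delta_mx 0 k).
Proof. by rewrite nth_mktuple vsprojK //; apply/symvP; rewrite tr_diag_mx. Qed.

(** Multiplying a relation between the projectors by one of them isolates its
    coefficient. *)
Lemma free_graph_projC : free graph_projC.
Proof.
apply/freeP => c c0 l.
have : \sum_k c k *: map_mx toC (graph_proj R e k) = 0.
  rewrite -[RHS](linear0 (@vsval _ _ (symv C (2 ^ N)))) -c0 linear_sum.
  by apply: eq_bigr => k _; rewrite linearZ /= vsval_graph_projC.
move/(congr1 (mulmx (map_mx toC (graph_proj R e l)))).
rewrite mulmx0 mulmx_sumr (bigD1 l) //= big1 => [|k kl].
  rewrite addr0 -scalemxAr -map_mxM graph_proj_mul // eqxx scale1r.
  move/eqP; rewrite scalemx_eq0 map_mx_eq0 (negPf (graph_proj_neq0 _ e l)).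
  by rewrite orbF => /eqP.
rewrite -scalemxAr -map_mxM graph_proj_mul // eq_sym (negPf kl) scale0r.
by rewrite map_mx0 scaler0.
Qed.

Lemma lincomb_unit_diag x : vsval (lincomb unit_diag x) = diag_mx x.
Proof.
rewrite linear_sum [in RHS](row_sum_delta x) linear_sum.
by apply: eq_bigr => k _; rewrite !linearZ /= vsval_unit_diag.
Qed.

Lemma free_unit_diag : free unit_diag.
Proof.
apply/freeP => c c0 l.
have := lincomb_unit_diag (\row_k c k); rewrite /lincomb.
under eq_bigr do rewrite mxE.
by rewrite c0 linear0 => /matrixP/(_ l l); rewrite !mxE eqxx mulr1n.
Qed.

Lemma exp_hamiltonian_spaceE :
  [set X : symmx R (2 ^ N) | exists2 A, A \in hamiltonian_space R e &
     vsval X = map_mx toC (expmx A)] =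
  lincomb graph_projC @` [set x | exists2 t : 'I_N -> C,
     (forall i, exists y, t i = toC (expR y)) &
     x = \row_k \prod_i t i ^ hypercube_mx N i k].
Proof.
have expC y : map_mx toC (expmx (\sum_i y i *: hamiltonian R e i)) =
    vsval (lincomb graph_projC
      (\row_k \prod_i toC (expR (y i)) ^ hypercube_mx N i k)).
  rewrite expmx_hamiltonian // map_mx_sum linear_sum.
  apply: eq_bigr => k _; rewrite map_mxZ linearZ /= vsval_graph_projC mxE.
  congr (_ *: _); rewrite rmorph_prod; apply: eq_bigr => i _.
  exact: fmorphXz.
apply/seteqP; split=> [X [A /hamiltonian_spaceP [y ->]]|].
  rewrite expC => /val_inj ->.
  exists (\row_k \prod_i toC (expR (y i)) ^ hypercube_mx N i k) => //.
  by exists (fun i => toC (expR (y i))) => // i; exists (y i).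
move=> _ [_ [t /choice [y ty] ->] <-].
exists (\sum_i y i *: hamiltonian R e i).
  by apply/hamiltonian_spaceP; exists y.
rewrite expC; congr (vsval (lincomb _ _)); apply/rowP => k; rewrite !mxE.
by apply: eq_bigr => i _; rewrite ty.
Qed.

End GibbsVariety.

Theorem theorem5p5 (R : realType) (N : nat) (e : rel 'I_N)
    (e_sym : symmetric e) (e_irrefl : irreflexive e) :
  independence_model_up_to_linear_change
    (gibbs_variety (hamiltonian_space R e)).
Proof.
have [phi phi_bij phiP] := free_extend_linear_bijection
  (free_graph_projC R e_sym) (free_unit_diag R N).
exists phi => //.
have phiE x : phi (lincomb (graph_projC R e) x) = lincomb (unit_diag R N) x.
  by rewrite linear_sum; apply: eq_bigr => k _; rewrite linearZ /= phiP.
rewrite /gibbs_variety exp_hamiltonian_spaceE //.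
rewrite zariski_closure_injective; last exact/lincomb_inj/free_graph_projC.
rewrite (monomial_map_dense _
  (D := [set z | exists y, z = real_complex R (expR y)])).
- rewrite image_comp; congr image.
  by apply/funext => x /=; rewrite phiE lincomb_unit_diag.
- by move=> n; exists (ln n.+1%:R); rewrite lnK ?posrE ?ltr0n // rmorph_nat.
- by move=> _ [y ->]; rewrite fmorph_eq0 expR_eq0.
Qed.
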